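(* (i) If $f_1,f_2,f_3,f_4\in\mathbb{R}[x,y]$ are pairwise non-proportional binary quadratic forms with $f_1^3+f_2^3=f_3^3+f_4^3$ forming an identity of Type$(T)$, then $T>0$ (in particular $T$ is real). (ii) There is no identity $f_1^3+f_2^3=f_3^3+f_4^3$ with $f_1,f_2,f_3,f_4\in\mathbb{Q}[x,y]$ pairwise non-proportional binary quadratic forms which is of Type$(2)$.
   Context: An identity $g_1^3+g_2^3=g_3^3+g_4^3$ among pairwise non-proportional binary quadratic forms is of Type$(T)$ if, perhaps after replacing it by one of its flips ($g_1^3-g_3^3=-g_2^3+g_4^3$ or $g_1^3-g_4^3=-g_2^3+g_3^3$, relabeled so as to read $h_1^3+h_2^3=h_3^3+h_4^3$ with each $h_j\in\{\pm g_k\}$), one has $h_1^3+h_2^3=h_3^3+h_4^3$ and $h_1+h_2=T(h_3+h_4)$. *)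

(* Defs.v *)
From HB Require Import structures.
From mathcomp Require Import all_boot all_order all_algebra.
From mathcomp Require Import reals.
From mathcomp Require Import complex mpoly.

Set Implicit Arguments.
Unset Strict Implicit.
Unset Printing Implicit Defensive.

Import GRing.Theory.
Local Open Scope ring_scope.

Section Identities.
Variable K : fieldType.
Implicit Types (p q g h : {mpoly K[2]}) (T : K).

(* The zero form is 2-homogeneous; it is ruled out by non-proportionality,
   since 0 is proportional to everything. *)
Definition binary_quadratic_form p : Prop := p \is 2.-homog.

Definition proportional p q : Prop :=
  exists a b : K, (a != 0 \/ b != 0) /\ a *: p = b *: q.

Definition pairwise_non_proportional g1 g2 g3 g4 : Prop :=
  [/\ ~ proportional g1 g2, ~ proportional g1 g3 & ~ proportional g1 g4] /\
  [/\ ~ proportional g2 g3, ~ proportional g2 g4 & ~ proportional g3 g4].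

Definition sum_of_cubes_identity g1 g2 g3 g4 : Prop :=
  g1 ^+ 3 + g2 ^+ 3 = g3 ^+ 3 + g4 ^+ 3.

Definition quadratic_cubes_identity g1 g2 g3 g4 : Prop :=
  [/\ [/\ binary_quadratic_form g1, binary_quadratic_form g2,
          binary_quadratic_form g3 & binary_quadratic_form g4],
      pairwise_non_proportional g1 g2 g3 g4
    & sum_of_cubes_identity g1 g2 g3 g4].

(* The quadruples (h1, h2, h3, h4) for which h1^3 + h2^3 = h3^3 + h4^3 is the
   given identity, its flip g1^3 - g3^3 = - g2^3 + g4^3, or its flip
   g1^3 - g4^3 = - g2^3 + g3^3. *)
Definition flip_of g1 g2 g3 g4 h1 h2 h3 h4 : Prop :=
  [\/ (h1, h2, h3, h4) = (g1, g2, g3, g4),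
      (h1, h2, h3, h4) = (g1, - g3, - g2, g4)
    | (h1, h2, h3, h4) = (g1, - g4, - g2, g3)].

Definition of_type T g1 g2 g3 g4 : Prop :=
  exists h1 h2 h3 h4,
    [/\ flip_of g1 g2 g3 g4 h1 h2 h3 h4,
        sum_of_cubes_identity h1 h2 h3 h4
      & h1 + h2 = T *: (h3 + h4)].

End Identities.

Definition complexify (R : realType) (p : {mpoly R[2]}) : {mpoly R[i][2]} :=
  map_mpoly (real_complex R) p.

(* Main.v *)
(** With [u = h3 + h4], [r = h3 - h4], [s = h1 - h2], dividing the identity
    [h1^3 + h2^3 = h3^3 + h4^3] by [u] gives [3 r^2 = (T^3 - 1) u^2 + 3 T s^2],
    which may be evaluated at a point where [u] does not vanish.  If [T < 0] over
    the reals, the right-hand side is negative there.  If [T = 2], the conic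
    [3 r^2 = 7 u^2 + 6 s^2] has no rational point, by descent at the prime 3. *)
Require Import Defs.
From HB Require Import structures.
From mathcomp Require Import all_boot all_order all_algebra.
From mathcomp Require Import reals.
From mathcomp Require Import complex mpoly.
From mathcomp Require Import ring lra zify.

Set Implicit Arguments.
Unset Strict Implicit.
Unset Printing Implicit Defensive.

Import Order.TTheory GRing.Theory Num.Theory.
Local Open Scope ring_scope.

Lemma proportionalNl (K : fieldType) (p q : {mpoly K[2]}) :
  proportional (- p) q -> proportional p q.
Proof.
move=> [a [b [ab0 pq]]]; exists (- a), b; rewrite oppr_eq0.
by split; rewrite // -pq scaleNr scalerN.
Qed.

Lemma proportionalNr (K : fieldType) (p q : {mpoly K[2]}) :
  proportional p (- q) -> proportional p q.
Proof.
move=> [a [b [ab0 pq]]]; exists a, (- b); rewrite oppr_eq0.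
by split; rewrite // pq scaleNr scalerN.
Qed.

Lemma meval_single (K : fieldType) (p : {mpoly K[2]}) (v : 'I_2 -> K) m0 :
  (forall m, m \in msupp p -> m != m0 -> p@_m * \prod_i v i ^+ m i = 0) ->
  p.@[v] = p@_m0 * \prod_i v i ^+ m0 i.
Proof.
move=> vanish; rewrite mevalE; have [m0p | m0Np] := boolP (m0 \in msupp p).
  rewrite (bigD1_seq m0) //= [X in _ + X]big_seq_cond [X in _ + X]big1 ?addr0 //.
  by move=> m /andP[mp mm0]; exact: vanish.
rewrite memN_msupp_eq0 // mul0r big_seq [LHS]big1 // => m mp; apply: vanish => //.
by apply: contraNneq m0Np => <-.
Qed.

(** Three points suffice over any field, even a finite one: the values at [(1, 0)] and [(0, 1)] are
    the coefficients of [x^2] and [y^2], and if both vanish then [p] is [c x y], with value [c] at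
    [(1, 1)]. *)
Lemma quadratic_form_nonvanishing (K : fieldType) (p : {mpoly K[2]}) :
  binary_quadratic_form p -> p != 0 -> exists v, p.@[v] != 0.
Proof.
move=> /dhomogP hp p0.
have deg2 m : m \in msupp p -> (m ord0 + m ord_max = 2)%N.
  move=> /hp /= mdeg2; rewrite -[RHS]mdeg2 mdegE big_ord_recl big_ord1.
  by congr (_ + m _)%N; apply/val_inj.
have mE (m m' : 'X_{1..2}) : m ord0 = m' ord0 -> m ord_max = m' ord_max -> m = m'.
  move=> e0 e1; apply/mnmP => i; have [->|->] // : i = ord0 \/ i = ord_max.
  by case: i => [[|[|]]] // ?; [left|right]; apply/val_inj.
pose v (a b : K) := fun i : 'I_2 => if i == ord0 then a else b.
have prodE a b (m : 'X_{1..2}) : \prod_i v a b i ^+ m i = a ^+ m ord0 * b ^+ m ord_max.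
  by rewrite big_ord_recl big_ord1 /v /=; congr (_ * _ ^+ m _); apply/val_inj.
pose m20 : 'X_{1..2} := [multinom (if i == ord0 then 2 else 0)%N | i < 2].
pose m02 : 'X_{1..2} := [multinom (if i == ord0 then 0 else 2)%N | i < 2].
pose m11 : 'X_{1..2} := [multinom 1%N | i < 2].
have c20 : p.@[v 1 0] = p@_m20.
  rewrite (@meval_single _ _ _ m20) ?prodE ?mnmE /= ?expr1n ?expr0 ?mulr1 //.
  (* Since [0 ^+ 0 = 1], a monomial survives at [(1, 0)] only if its second exponent is 0; degree 2
     then forces it to be [m20]. *)
  move=> m mp nm; rewrite prodE [0 ^+ _]expr0n; case: eqP => [m1|_]; last by rewrite !mulr0.
  by case/eqP: nm; have := deg2 _ mp; rewrite m1 addn0 => m0; apply: mE; rewrite mnmE.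
have c02 : p.@[v 0 1] = p@_m02.
  rewrite (@meval_single _ _ _ m02) ?prodE ?mnmE /= ?expr1n ?expr0 ?mulr1 //.
  move=> m mp nm; rewrite prodE [0 ^+ _]expr0n; case: eqP => [m0|_]; last by rewrite mul0r mulr0.
  by case/eqP: nm; have := deg2 _ mp; rewrite m0 add0n => m1; apply: mE; rewrite mnmE.
have cases m : m \in msupp p -> [\/ m = m20, m = m02 | m = m11].
  move=> mp; have := deg2 _ mp.
  case e0: (m ord0) => [|[|[|k]]] // e1.
  - by apply: Or32; apply: mE; rewrite mnmE //= ?e0; lia.
  - by apply: Or33; apply: mE; rewrite mnmE //= ?e0; lia.
  - by apply: Or31; apply: mE; rewrite mnmE //= ?e0; lia.
have [n20|z20] := boolP (p@_m20 != 0); first by exists (v 1 0); rewrite c20.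
have [n02|z02] := boolP (p@_m02 != 0); first by exists (v 0 1); rewrite c02.
move: z20 z02 => /negPn/eqP z20 /negPn/eqP z02.
exists (v 1 1); rewrite (@meval_single _ _ _ m11).
  rewrite prodE !expr1n !mulr1; apply: contraNneq p0 => z11.
  apply/eqP/mpolyP => m; rewrite mcoeff0.
  have [/cases [] -> //|] := boolP (m \in msupp p).
  exact: memN_msupp_eq0.
by move=> m /cases [] -> => [_|_|/eqP]; rewrite ?z20 ?z02 ?mul0r.
Qed.

Lemma sum_nonvanishing (K : fieldType) (p q : {mpoly K[2]}) :
  binary_quadratic_form p -> binary_quadratic_form q -> ~ proportional p q ->
  exists v, (p + q).@[v] != 0.
Proof.
move=> hp hq npq; apply: quadratic_form_nonvanishing; first exact: rpredD.
apply/eqP => pq0; apply: npq; exists 1, (-1).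
split; first by left; rewrite oner_neq0.
by rewrite scale1r scaleN1r; apply/eqP; rewrite -addr_eq0 pq0.
Qed.

(** Flips only permute the forms and change signs, which respects non-proportionality, so all three
    cases can be treated as one. The sum [h3 + h4] is the [u] of the conic; [h1 + h2] serves to
    exclude [T = 0]. *)
Lemma flip_quadratic_cubes_identity (K : fieldType)
    (f1 f2 f3 f4 h1 h2 h3 h4 : {mpoly K[2]}) :
  quadratic_cubes_identity f1 f2 f3 f4 ->
  flip_of f1 f2 f3 f4 h1 h2 h3 h4 ->
  [/\ exists v, (h1 + h2).@[v] != 0, exists v, (h3 + h4).@[v] != 0
    & sum_of_cubes_identity h1 h2 h3 h4].
Proof.
rewrite /sum_of_cubes_identity /binary_quadratic_form.
move=> [[q1 q2 q3 q4] [[n12 n13 n14] [n23 n24 n34]] eqf].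
have e3 : f3 ^+ 3 = f1 ^+ 3 + f2 ^+ 3 - f4 ^+ 3 by rewrite eqf addrK.
have e4 : f4 ^+ 3 = f1 ^+ 3 + f2 ^+ 3 - f3 ^+ 3 by rewrite eqf addrC addKr.
case=> -[-> -> -> ->]; split=> //;
  try (apply: sum_nonvanishing; rewrite /binary_quadratic_form ?rpredN //).
- by move/proportionalNr.
- by move/proportionalNl.
- by rewrite e4; ring.
- by move/proportionalNr.
- by move/proportionalNl.
- by rewrite e3; ring.
Qed.

(** Brings the complex quadruple in [of_type] back to real forms: [complexify] commutes with
    negation. *)
Lemma flip_of_complexify (R : realType) (f1 f2 f3 f4 : {mpoly R[2]}) h1 h2 h3 h4 :
  flip_of (complexify f1) (complexify f2) (complexify f3) (complexify f4) h1 h2 h3 h4 ->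
  exists k1 k2 k3 k4, flip_of f1 f2 f3 f4 k1 k2 k3 k4 /\
    (h1, h2, h3, h4) = (complexify k1, complexify k2, complexify k3, complexify k4).
Proof.
have cN p : complexify (- p) = - complexify p :> {mpoly R[i][2]} by exact: raddfN.
case=> ->; [exists f1, f2, f3, f4 | exists f1, (- f3), (- f2), f4
  | exists f1, (- f4), (- f2), f3]; rewrite ?cN; split=> //.
- exact: Or31.
- exact: Or32.
- exact: Or33.
Qed.

Lemma complexifyD (R : realType) (p q : {mpoly R[2]}) :
  complexify (p + q) = complexify p + complexify q.
Proof. exact: raddfD. Qed.

Lemma complexify_eval (R : realType) (p : {mpoly R[2]}) (v : 'I_2 -> R) :
  (complexify p).@[fun i => real_complex R (v i)] = real_complex R p.@[v].
Proof.
elim/mpolyind: p => [|c m p _ _ IH]; first by rewrite /complexify !raddf0.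
rewrite complexifyD [complexify (c *: _)]map_mpolyZ map_mpolyX.
rewrite !mevalD !mevalZ !mevalX IH.
rewrite [RHS]rmorphD [X in _ = X + _]rmorphM [X in _ = _ * X + _]rmorph_prod.
by congr (_ * _ + _); apply: eq_bigr => i _; rewrite [RHS]rmorphXn.
Qed.

(** Apply [4 (a^3 + b^3) = (a + b)^3 + 3 (a + b) (a - b)^2] to both sides of the cubes identity,
    substitute [x1 + x2 = t (x3 + x4)] and cancel [x3 + x4]. *)
Lemma type_conic (K : fieldType) (x1 x2 x3 x4 t : K) :
  x1 ^+ 3 + x2 ^+ 3 = x3 ^+ 3 + x4 ^+ 3 -> x1 + x2 = t * (x3 + x4) ->
  x3 + x4 != 0 ->
  3 * (x3 - x4) ^+ 2 = (t ^+ 3 - 1) * (x3 + x4) ^+ 2 + 3 * t * (x1 - x2) ^+ 2.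
Proof.
move=> cubes sumE u0; apply: (mulfI u0).
have -> : (x3 + x4) * (3 * (x3 - x4) ^+ 2) = 4 * (x3 ^+ 3 + x4 ^+ 3) - (x3 + x4) ^+ 3 by ring.
rewrite -cubes.
have -> : (x3 + x4) * ((t ^+ 3 - 1) * (x3 + x4) ^+ 2 + 3 * t * (x1 - x2) ^+ 2)
  = (t * (x3 + x4)) ^+ 3 + 3 * (t * (x3 + x4)) * (x1 - x2) ^+ 2 - (x3 + x4) ^+ 3 by ring.
by rewrite -sumE; ring.
Qed.

Lemma type_ge0 (R : realFieldType) (x1 x2 x3 x4 t : R) :
  x1 ^+ 3 + x2 ^+ 3 = x3 ^+ 3 + x4 ^+ 3 -> x1 + x2 = t * (x3 + x4) ->
  x3 + x4 != 0 -> 0 <= t.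
Proof.
move=> cubes sumE u0; have conic := type_conic cubes sumE u0.
rewrite leNgt; apply/negP => t0.
have t3 : t ^+ 3 < 0 by rewrite exprn_odd_lt0.
have u2 : 0 < (x3 + x4) ^+ 2 by rewrite exprn_even_gt0.
have r2 := sqr_ge0 (x3 - x4); have s2 := sqr_ge0 (x1 - x2).
have tu : (t ^+ 3 - 1) * (x3 + x4) ^+ 2 < 0 by rewrite pmulr_llt0 //; lra.
have ts : t * (x1 - x2) ^+ 2 <= 0 by rewrite mulr_le0_ge0 // ltW.
move: conic; rewrite -mulrA; lra.
Qed.

(** Descent on [u]: modulo 3 the equation gives [u = 3 u'], hence [r^2 = 21 u'^2 + 2 s^2], which
    forces 3 to divide [r] and [s]; then [(r', u', s')] solves the same equation with [u' < u]. *)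
Lemma conic_nat (r u s : nat) :
  (3 * r ^ 2 = 7 * u ^ 2 + 6 * s ^ 2)%N -> u = 0%N.
Proof.
elim/ltn_ind: u r s => u IH r s conic.
have [//|u_gt0] := posnP u.
have dvd3_sqr n : (3 %| n ^ 2)%N -> (3 %| n)%N by rewrite Euclid_dvdX // andbT.
have /dvdnP[u' uE] : (3 %| u)%N by apply: dvd3_sqr; lia.
have rsE : (r ^ 2 = 21 * u' ^ 2 + 2 * s ^ 2)%N by nia.
have mod3 n : (n ^ 2 %% 3 = (n %% 3 != 0))%N.
  by rewrite -modnXm; have := ltn_pmod n (isT : 0 < 3)%N; case: (n %% 3)%N => [|[|[|]]].
have [r3 s3] : (3 %| r)%N /\ (3 %| s)%N.
  (* Here [r^2] is congruent to [2 s^2], and 2 is not a square modulo 3. *)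
  by move: (mod3 r) (mod3 s); rewrite /dvdn; do 2 case: eqP => ? /=; lia.
move: r3 s3 => /dvdnP[r' rE] /dvdnP[s' sE].
by rewrite uE (IH u' _ r' s') //; [lia | nia].
Qed.

(** The equation is homogeneous, so multiplying by the common denominator [d] gives an integer
    solution; only squares occur, so absolute values give a natural one. *)
Lemma conic_rat (r u s : rat) :
  3 * r ^+ 2 = 7 * u ^+ 2 + 6 * s ^+ 2 -> u = 0.
Proof.
move=> conic; pose d := denq r * denq u * denq s.
pose r' := numq r * denq u * denq s.
pose u' := numq u * denq r * denq s.
pose s' := numq s * denq r * denq u.
have dr := denq_neq0 r; have du := denq_neq0 u; have ds := denq_neq0 s.
have rE : (r'%:~R = d%:~R * r :> rat).
  by rewrite -[in RHS](divq_num_den r) /r' /d; field; rewrite intr_eq0.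
have uE : (u'%:~R = d%:~R * u :> rat).
  by rewrite -[in RHS](divq_num_den u) /u' /d; field; rewrite intr_eq0.
have sE : (s'%:~R = d%:~R * s :> rat).
  by rewrite -[in RHS](divq_num_den s) /s' /d; field; rewrite intr_eq0.
have conicZ : 3 * r' ^+ 2 = 7 * u' ^+ 2 + 6 * s' ^+ 2.
  clearbody r' u' s' d.
  apply/(@intr_inj rat); rewrite !expr2 intrD !intrM rE uE sE.
  rewrite [LHS](_ : _ = d%:~R ^+ 2 * (3 * r ^+ 2)); last by ring.
  by rewrite conic; ring.
have sqr_absz (n : int) : (`|n| ^ 2)%N%:Z = n ^+ 2 by rewrite -abszX gez0_abs ?sqr_ge0.
have /conic_nat/eqP : (3 * `|r'| ^ 2 = 7 * `|u'| ^ 2 + 6 * `|s'| ^ 2)%N.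
  by apply/eqP; rewrite -eqz_nat PoszD (PoszM 3) (PoszM 7) (PoszM 6) !sqr_absz conicZ.
by rewrite absz_eq0 /u' !mulf_eq0 (negPf dr) (negPf ds) !orbF numq_eq0 => /eqP.
Qed.

(* T ranges over the complex numbers; in the order of R[i], 0 < T means that
   T has zero imaginary part and positive real part. *)
Theorem theorem4p4 :
  (forall (R : realType) (f1 f2 f3 f4 : {mpoly R[2]}) (T : R[i]),
     quadratic_cubes_identity f1 f2 f3 f4 ->
     of_type T (complexify f1) (complexify f2) (complexify f3) (complexify f4) ->
     0 < T)
  /\
  ~ (exists f1 f2 f3 f4 : {mpoly rat[2]},
       quadratic_cubes_identity f1 f2 f3 f4 /\
       of_type (2%:R : rat) f1 f2 f3 f4).
Proof.
split.
  move=> R f1 f2 f3 f4 T quad [h1 [h2 [h3 [h4 [flip _ sumE]]]]].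
  have [k1 [k2 [k3 [k4 [flipk [h1E h2E h3E h4E]]]]]] := flip_of_complexify flip.
  have [[w kw] [v uv] cubes] := flip_quadratic_cubes_identity quad flipk.
  have {}sumE : complexify (k1 + k2) = T *: complexify (k3 + k4).
    by rewrite (complexifyD k1) (complexifyD k3) -h1E -h2E -h3E -h4E.
  have evalE x : real_complex R (k1 + k2).@[x] = T * real_complex R (k3 + k4).@[x].
    by rewrite -(complexify_eval (k1 + k2)) -(complexify_eval (k3 + k4)) sumE mevalZ.
  (* Evaluating at a real point where [k3 + k4] does not vanish shows that [T] is a quotient of real
     numbers. *)
  pose t := (k1 + k2).@[v] / (k3 + k4).@[v].
  have TE : T = real_complex R t.
    have uvC : real_complex R (k3 + k4).@[v] != 0 by rewrite fmorph_eq0.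
    by apply: (mulIf uvC); rewrite -evalE -rmorphM divfK.
  have t_ge0 : 0 <= t.
    apply: (@type_ge0 _ k1.@[v] k2.@[v] k3.@[v] k4.@[v]); rewrite -?mevalD //.
    - by have := congr1 (meval v) cubes; rewrite !mevalD !rmorphXn.
    - by rewrite divfK.
  (* If [T] were 0, then [k1 + k2] would vanish everywhere, in particular at [w]. *)
  have T_neq0 : T != 0.
    by apply: contraNneq kw => T0; have /eqP := evalE w; rewrite T0 mul0r fmorph_eq0.
  by rewrite lt_neqAle eq_sym T_neq0 TE ler0c.
move=> [f1 [f2 [f3 [f4 [quad [h1 [h2 [h3 [h4 [flip cubes sumE]]]]]]]]]].
have [_ [v uv] _] := flip_quadratic_cubes_identity quad flip.
have := congr1 (meval v) cubes; rewrite !mevalD !rmorphXn /= => cubesv.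
have := congr1 (meval v) sumE; rewrite mevalZ !mevalD => sumv.
rewrite mevalD in uv; have conic := type_conic cubesv sumv uv.
(* For [t = 2] the coefficients [t^3 - 1] and [3 t] are 7 and 6. *)
case/eqP: uv; apply: (@conic_rat (h3.@[v] - h4.@[v]) _ (h1.@[v] - h2.@[v])).
by rewrite conic; ring.
Qed.
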